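(* Let $n$ and $k$ be integers with $0 \le k \le n$, and let $P \subset \mathbb{C}^2$ be a set of $2n-k$ distinct points, of which $n$ are coloured green and $n-k$ are coloured red. Suppose that at most $2n-k-2$ points of $P$ lie on any (complex) line. Then the number of $1$-equichromatic lines determined by $P$ that contain at most six points of $P$ is at least $\frac{1}{4}\bigl(6n - k(k+3)\bigr)$.
   Context: A line in $\mathbb{C}^2$ is said to be determined by $P$ if it contains at least two points of $P$. For an integer $r \ge 0$, a line is called $r$-equichromatic if it contains exactly $i$ green and $j$ red points of $P$ with $i + j \ge 2$ and $|i - j| \le r$. A line ''passing through at most six points'' means it contains at most six points of $P$. *)

(* Defs.v *)
From HB Require Import structures.
From mathcomp Require Import all_boot all_order all_algebra.
From mathcomp Require Import finmap.
From mathcomp Require Import complex.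
From mathcomp Require Import boolp reals.
Set Implicit Arguments. Unset Strict Implicit. Unset Printing Implicit Defensive.
Import Order.TTheory GRing.Theory Num.Theory.
Local Open Scope ring_scope.
Local Open Scope fset_scope.

Definition pt (R : realType) := (R[i] * R[i])%type.

Definition is_line (R : realType) (a b : R[i]) : bool := (a != 0) || (b != 0).
Definition on_line (R : realType) (a b c : R[i]) (p : pt R) : bool :=
  (a * p.1 + b * p.2 == c)%R.

Definition pts_on (R : realType) (P : {fset pt R}) (a b c : R[i]) : {fset pt R} :=
  [fset p in P | on_line a b c p].

(* S is the trace P ∩ L of a line L determined by P (|P ∩ L| >= 2).
   Lines determined by P are in bijection with such traces. *)
Definition det_trace (R : realType) (P S : {fset pt R}) : Prop :=
  (2 <= #|` S|)%N /\ exists a b c : R[i], is_line a b && (S == pts_on P a b c).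

Definition equichromatic (r i j : nat) : bool :=
  [&& (2 <= i + j)%N, (i <= j + r)%N & (j <= i + r)%N].

Definition equi_lines (R : realType) (r m : nat) (G Rd : {fset pt R})
  : {fset {fset pt R}} :=
  [fset S in fpowerset (G `|` Rd) |
     `[< det_trace (G `|` Rd) S >] && (#|` S| <= m)%N &&
     equichromatic r #|` S `&` G| #|` S `&` Rd|].

(* Main.v *)
(** The geometric input is Hirzebruch's inequality
      t_2 + t_3 >= N + sum_(s > 4) (s - 4) t_s
    (t_s lines with s points, no line with N - 1 or more), for which there is a
    proof avoiding the Bogomolov-Miyaoka-Yau inequality.  Suppose first that every line has at
    most 2N/3 points, and lift the points to vectors of C^3.  For g in GL_3 put
    u_i = v_i g / |v_i g|.  Each line spans a plane, so its s unit vectors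
    contribute at least s^2/2 to the frame potential sum_(i, j) |<u_i, u_j>|^2.
    On the other hand g can be chosen with frame potential arbitrarily close to
    N^2/3: the scale-invariant product prod_i |v_i g|^6 / |det g|^(2N) is bounded
    below by a positive constant (choose a basis of v greedily), while
    renormalizing g by the principal axes of the frame lowers it by a fixed
    factor as long as the frame potential is bounded away from N^2/3.  Hence
    3 sum_l s(s - 2) <= 2 N (N - 3), which is Langer's inequality and implies
    Hirzebruch's because sum_l s(s - 1) = N (N - 1).  If some line has more than
    2N/3 points, the lines joining it to the points off it are numerous enough.

    Finally, a line with i green and j red points contributes
    (i + j) - (i - j)^2 to a total of N - k^2, by comparing the numbers of
    bichromatic and monochromatic pairs; adding twice Hirzebruch's inequality
    leaves a contribution of at most 4 from equichromatic lines with at most six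
    points, and at most 0 from all others. *)
Require Import Defs.
From HB Require Import structures.
From mathcomp Require Import all_boot all_order all_algebra.
From mathcomp Require Import finmap complex boolp reals.
From mathcomp Require classical_sets.
From mathcomp Require Import perm spectral sesquilinear ring lra zify.
Set Implicit Arguments. Unset Strict Implicit. Unset Printing Implicit Defensive.
Import Order.TTheory GRing.Theory Num.Theory.
Local Open Scope ring_scope.
Local Open Scope complex_scope.

(** * Principal axes of a weighted frame *)

Local Open Scope sesquilinear_scope.

Section HermitianNorm.
Context {R : realType}.
Implicit Types (z : R[i]) (n : nat).

Lemma realCM (x y : R) : (x * y)%:C = x%:C * y%:C :> R[i].
Proof. exact: rmorphM. Qed.

Lemma realC_sum (J : finType) (Q : pred J) (F : J -> R) :
  (\sum_(j | Q j) F j)%:C = \sum_(j | Q j) (F j)%:C :> R[i].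
Proof. exact: rmorph_sum. Qed.

Definition sqn z : R := complex.Re z ^+ 2 + complex.Im z ^+ 2.

Lemma sqnE z : (sqn z)%:C = z * Num.conj z.
Proof. by rewrite /sqn add_Re2_Im2 normCK. Qed.

Lemma sqn_ge0 z : 0 <= sqn z.
Proof. by rewrite addr_ge0 ?sqr_ge0. Qed.

Lemma sqn_eq0 z : (sqn z == 0) = (z == 0).
Proof.
by rewrite -(inj_eq (@complexI R)) sqnE mulf_eq0 conjC_eq0 orbb.
Qed.

Lemma sqnM z z' : sqn (z * z') = sqn z * sqn z'.
Proof. by apply: complexI; rewrite realCM !sqnE rmorphM mulrACA. Qed.

Lemma sqn1 : sqn 1 = 1.
Proof. by rewrite /sqn expr1n expr0n addr0. Qed.

Lemma sqnR (x : R) : sqn x%:C = x ^+ 2.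
Proof. by rewrite /sqn expr0n addr0. Qed.

Definition dotc n (u v : 'rV[R[i]]_n) : R[i] := \sum_k u 0 k * Num.conj (v 0 k).
Definition nrm2 n (u : 'rV[R[i]]_n) : R := \sum_k sqn (u 0 k).

Lemma dotcE n (u v : 'rV[R[i]]_n) : dotc u v = (u *m v^t*) 0 0.
Proof. by rewrite mxE; apply: eq_bigr => k _; rewrite !mxE. Qed.

Lemma nrm2E n (u : 'rV[R[i]]_n) : (nrm2 u)%:C = dotc u u.
Proof. by rewrite realC_sum; apply: eq_bigr => k _; rewrite sqnE. Qed.

Lemma dotc_unitary n (P : 'M[R[i]]_n) (u v : 'rV[R[i]]_n) :
  P \is unitarymx -> dotc (u *m P) (v *m P) = dotc u v.
Proof.
by move=> /unitarymxP PP; rewrite !dotcE trmx_mul map_mxM mulmxA -(mulmxA u) PP mulmx1.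
Qed.

Lemma nrm2_unitary n (P : 'M[R[i]]_n) (u : 'rV[R[i]]_n) :
  P \is unitarymx -> nrm2 (u *m P) = nrm2 u.
Proof. by move=> Pu; apply: complexI; rewrite !nrm2E dotc_unitary. Qed.

Lemma nrm2_ge0 n (u : 'rV[R[i]]_n) : 0 <= nrm2 u.
Proof. by apply: sumr_ge0 => k _; apply: sqn_ge0. Qed.

Lemma nrm2_eq0 n (u : 'rV[R[i]]_n) : (nrm2 u == 0) = (u == 0).
Proof.
rewrite psumr_eq0; last by move=> k _; apply: sqn_ge0.
apply/allP/eqP => [u0|-> k _]; last by rewrite mxE sqn_eq0 eqxx.
apply/rowP => k; rewrite mxE; apply/eqP; rewrite -sqn_eq0.
by apply: u0; rewrite mem_index_enum.
Qed.

Lemma nrm2_gt0 n (u : 'rV[R[i]]_n) : (0 < nrm2 u) = (u != 0).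
Proof. by rewrite lt_neqAle nrm2_ge0 andbT eq_sym nrm2_eq0. Qed.

(** The Hermitian frame matrix [H], the sum of the a_i w_i^* w_i, is diagonalized by the spectral
    theorem. [P] is the adjoint of the diagonalizing unitary matrix, and [d] lists the
    eigenvalues. *)
Lemma principal_axes n (I : finType) (A : {set I}) (a : I -> R) (w : I -> 'rV[R[i]]_n) :
  exists P : 'M[R[i]]_n, exists2 d : 'I_n -> R, P \is unitarymx &
    forall k l, \sum_(i in A) (a i)%:C * ((w i *m P) 0 k * Num.conj ((w i *m P) 0 l))
      = (if k == l then d k else 0)%:C.
Proof.
pose H := \sum_(i in A) (a i)%:C *: ((w i)^t* *m w i).
have Hh : H \is hermsymmx.
  rewrite is_hermitianmxE expr0 scale1r; apply/eqP.
  rewrite /H !linear_sum /= map_mx_sum; apply: eq_bigr => i _.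
  rewrite linearZ /= map_mxZ trmx_mul map_mxM /= trmxCK.
  by congr (_ *: _); apply/esym/conj_Creal; rewrite complex_real.
have Hd := hermitian_spectral_diag_real Hh.
have /hermitian_normalmx/orthomx_spectralP HE := Hh.
set U := spectralmx H in HE; set D := spectral_diag H in HE Hd.
have Uu : U \is unitarymx by apply: spectral_unitarymx.
exists (U^t*), (fun k => complex.Re (D 0 k)); first by rewrite trmxC_unitary.
have UHU : U *m H *m U^t* = diag_mx D.
  by rewrite HE invmx_unitary // !mulmxA (unitarymxP Uu) mul1mx mulmxtVK.
move=> k l; move/matrixP/(_ l k): UHU.
rewrite [RHS]mxE => UHU.
transitivity (D 0 l *+ (l == k)); last first.
  rewrite eq_sym; case: eqP => [->|_]; last by rewrite mulr0n rmorph0.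
  by rewrite mulr1n RRe_real // (mxOverP Hd).
rewrite -UHU /H mulmx_sumr mulmx_suml summxE; apply: eq_bigr => i _.
rewrite -scalemxAr -scalemxAl [RHS]mxE; congr (_ * _).
rewrite mulmxA -(mulmxA _ (w i)) [RHS]mxE big_ord1 mulrC; congr (_ * _).
rewrite [RHS]mxE mxE rmorph_sum; apply: eq_bigr => j _.
by rewrite [LHS]rmorphM /= !mxE mulrC; congr (_ * _); apply: conjCK.
Qed.

End HermitianNorm.

Section PrincipalAxes.
Context {R : realType} (n : nat) (I : finType) (A : {set I}) (a : I -> R)
  (w : I -> 'rV[R[i]]_n) (P : 'M[R[i]]_n) (d : 'I_n -> R).
Context (Pu : P \is unitarymx).
Context (Pd : forall k l,
  \sum_(i in A) (a i)%:C * ((w i *m P) 0 k * Num.conj ((w i *m P) 0 l))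
      = (if k == l then d k else 0)%:C).

Lemma axis_weight k : d k = \sum_(i in A) a i * sqn ((w i *m P) 0 k).
Proof.
apply: complexI; have := Pd k k; rewrite eqxx => <-.
by rewrite realC_sum; apply: eq_bigr => i _; rewrite realCM sqnE.
Qed.

Lemma sum_axis_weight : \sum_k d k = \sum_(i in A) a i * nrm2 (w i).
Proof.
under eq_bigr do rewrite axis_weight.
rewrite exchange_big /=; apply: eq_bigr => i _.
by rewrite -(nrm2_unitary (w i) Pu) /nrm2 mulr_sumr.
Qed.

(** Both sides are the trace of the squared frame matrix, computed in the eigenbasis and expanded
    over pairs of vectors. *)
Lemma sum_axis_weight2 :
  \sum_k d k ^+ 2 = \sum_(i in A) \sum_(j in A) a i * a j * sqn (dotc (w i) (w j)).
Proof.
apply: complexI; rewrite !realC_sum.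
pose M k l := \sum_(i in A) (a i)%:C * ((w i *m P) 0 k * Num.conj ((w i *m P) 0 l)).
transitivity (\sum_k \sum_l M k l * M l k).
  apply: eq_bigr => k _; rewrite (bigD1 k) //= big1 => [|l lk].
    by rewrite addr0 /M Pd eqxx -realCM expr2.
  by rewrite /M Pd eq_sym (negbTE lk) mul0r.
under eq_bigr => k _ do under eq_bigr => l _ do rewrite /M big_distrlr /=.
under eq_bigr => k _ do rewrite exchange_big.
rewrite exchange_big; apply: eq_bigr => i _.
rewrite realC_sum.
under eq_bigr => k _ do rewrite exchange_big.
rewrite exchange_big; apply: eq_bigr => j _ /=.
rewrite !realCM sqnE -(dotc_unitary (w i) (w j) Pu) /dotc [Num.conj _]rmorph_sum /=.
rewrite big_distrlr mulr_sumr; apply: eq_bigr => k _.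
rewrite mulr_sumr; apply: eq_bigr => l _ /=.
rewrite rmorphM /= conjCK.
ring.
Qed.

(** A common null vector of the w_i is killed by the frame matrix. In the eigenbasis this reads d_l
    c'_l = 0, and some coordinate c'_l is nonzero. *)
Lemma axis_weight_kernel (c : 'cV[R[i]]_n) : c != 0 ->
  (forall i, i \in A -> w i *m c = 0) -> exists k, d k = 0.
Proof.
move=> c0 wc; have PP := unitarymxP Pu.
pose c' := P^t* *m c.
have : c' != 0.
  by apply: contra c0 => /eqP c'0; rewrite -[c]mul1mx -PP -mulmxA -/c' c'0 mulmx0.
have [l cl|c'0] := pickP (fun l => c' l 0 != 0); last first.
  case/eqP; apply/matrixP => l j; rewrite ord1 [RHS]mxE.
  by have := c'0 l; move/negbFE/eqP.
move=> _; exists l; apply: complexI.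
suff /eqP : (d l)%:C * c' l 0 = 0 by rewrite mulf_eq0 (negbTE cl) orbF => /eqP.
transitivity (\sum_k (if k == l then d k else 0)%:C * c' k 0).
  by rewrite (bigD1 l) //= eqxx big1 ?addr0 // => k /negbTE ->; rewrite mul0r.
under eq_bigr => k _ do rewrite -Pd mulr_suml.
rewrite exchange_big big1 //= => i iA.
have : (w i *m P *m c') 0 0 = 0.
  rewrite /c' mulmxA -(mulmxA (w i)) PP mulmx1 wc // mxE //.
rewrite mxE => wc0.
transitivity ((a i)%:C * Num.conj ((w i *m P) 0 l) * \sum_j (w i *m P) 0 j * c' j 0).
  by rewrite mulr_sumr; apply: eq_bigr => j _; ring.
by rewrite wc0 mulr0.
Qed.
End PrincipalAxes.

(* In a plane the frame has at most two nonzero principal weights. *)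
Lemma planar_frame_potential {R : realType} (I : finType) (A : {set I}) (a : I -> R)
    (w : I -> 'rV[R[i]]_3) (c : 'cV[R[i]]_3) : c != 0 ->
    (forall i, i \in A -> w i *m c = 0) ->
  (\sum_(i in A) a i * nrm2 (w i)) ^+ 2 <=
  2 * \sum_(i in A) \sum_(j in A) a i * a j * sqn (dotc (w i) (w j)).
Proof.
move=> c0 wc; have [P [d Pu Pd]] := principal_axes A a w.
rewrite -(sum_axis_weight Pu Pd) -(sum_axis_weight2 Pu Pd).
have [k dk] := axis_weight_kernel Pu Pd c0 wc.
have : [|| d ord0 == 0, d (lift ord0 ord0) == 0 | d (lift ord0 (lift ord0 ord0)) == 0].
  case: k dk => [[|[|[|//]]] k3] dk; apply/or3P;
  [apply: Or31|apply: Or32|apply: Or33]; rewrite -dk; apply/eqP; congr d; exact: val_inj.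
rewrite !big_ord_recl !big_ord0 !addr0.
set x := d ord0; set y := d (lift _ _); set z := d (lift _ _).
by case/or3P=> /eqP ->; [have := sqr_ge0 (y - z)|have := sqr_ge0 (x - z)
  |have := sqr_ge0 (x - y)]; nra.
Qed.

(** * Scaling a frame *)

(** Newton's inequality 3 e_1 e_3 <= e_2^2 for elementary symmetric functions, where 2 e_2 = N^2 -
    (x^2 + y^2 + z^2) <= N^2 - s. *)
Lemma newton3 {R : realFieldType} (x y z N s : R) : 0 < x -> 0 < y -> 0 < z ->
  x + y + z = N -> s <= x ^+ 2 + y ^+ 2 + z ^+ 2 ->
  x * y * z <= ((N ^+ 2 - s) / 2) ^+ 2 / (3 * N).
Proof.
move=> x0 y0 z0 <- hs; rewrite ler_pdivlMr; last by lra.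
set e := ((_ - _) / 2).
have e2 : x * y + y * z + z * x <= e by rewrite /e; lra.
have : (x * y + y * z + z * x) ^+ 2 <= e ^+ 2.
  by rewrite lerXn2r // nnegrE; [nra|apply: le_trans e2; nra].
apply: le_trans.
have := sqr_ge0 (x * y - y * z); have := sqr_ge0 (y * z - z * x).
by have := sqr_ge0 (z * x - x * y); nra.
Qed.

Section Scaling.
Context {R : realType} (I : finType) (v : I -> 'rV[R[i]]_3).

(** Both sides have degree 6 [#|I|] in [g], so this bounds a scale-invariant quotient from below;
    clearing the denominator admits singular [g]. *)
Definition scaling_bound (c : R) := forall g : 'M[R[i]]_3,
  c * sqn (\det g) ^+ #|I| <= \prod_i nrm2 (v i *m g) ^+ 3.

Definition frame_potential (g : 'M[R[i]]_3) : R :=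
  \sum_i \sum_j (nrm2 (v i *m g))^-1 * (nrm2 (v j *m g))^-1 *
    sqn (dotc (v i *m g) (v j *m g)).

(** The bound [c] is applied not to [g] but to its renormalization along the principal axes. AM-GM
    controls the new norms and [newton3] the new determinant. *)
Lemma scaling_step (c s : R) (g : 'M[R[i]]_3) :
  (0 < #|I|)%N -> 0 <= c ->
  (forall i, v i != 0) ->
  (forall x : 'cV[R[i]]_3, x != 0 -> exists i, v i *m x != 0) ->
  g \in unitmx -> s <= frame_potential g -> scaling_bound c ->
  c * sqn (\det g) ^+ #|I| <=
  ((3 / 2 * (1 - s / #|I|%:R ^+ 2)) ^+ 2) ^+ #|I| * \prod_i nrm2 (v i *m g) ^+ 3.
Proof.
move=> I0 c0 v0 vspan gu; rewrite /frame_potential.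
set N := #|I|; pose w i := v i *m g; pose q i := nrm2 (w i).
have N0 : 0 < N%:R :> R by rewrite ltr0n.
rewrite -/(q _) => hs hc.
have q0 i : 0 < q i.
  rewrite nrm2_gt0 /w; apply: contra (v0 i) => /eqP vg.
  by rewrite -[v i](mulmxK gu) vg mul0mx.
have qn0 i : q i != 0 by rewrite gt_eqF.
have [P [d Pu Pd]] := principal_axes [set: I] (fun i => (q i)^-1) w.
have dE := axis_weight Pd.
have dsum : \sum_k d k = N%:R.
  rewrite (sum_axis_weight Pu Pd) (eq_bigr (fun _ => 1)) => [|i _]; last first.
    by rewrite -/(q i) mulVf.
  by rewrite sumr_const cardsT.
have dsum2 : s <= \sum_k d k ^+ 2.
  rewrite (sum_axis_weight2 Pu Pd); apply: (le_trans hs).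
  rewrite le_eqVlt; apply/orP; left; apply/eqP.
  by apply: eq_big => [i|i _]; rewrite ?in_setT //; apply: eq_bigl => j; rewrite in_setT.
(* Column k of the invertible g P is nonzero, so some v_i has a nonzero k-th coordinate and
   contributes to d_k. *)
have d0 k : 0 < d k.
  have gPu : g *m P \in unitmx by rewrite unitmx_mul gu unitarymx_unit.
  have [|i vi] := vspan (col k (g *m P)).
    apply/eqP => gPk; have /row_freeP[B BP] : row_free (g *m P)^T.
      by rewrite row_free_unit unitmx_tr.
    have := congr1 (row k) BP; rewrite row_mul -tr_col gPk trmx0 mul0mx => /esym.
    by move/rowP/(_ k); rewrite !mxE eqxx => /eqP; rewrite oner_eq0.
  rewrite dE (bigD1 i) ?in_setT //= ltr_pwDl //; last first.
    by apply: sumr_ge0 => j _; rewrite mulr_ge0 ?sqn_ge0 // invr_ge0 ltW.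
  rewrite mulr_gt0 ?invr_gt0 // lt_neqAle sqn_ge0 andbT eq_sym sqn_eq0 /w.
  apply: contra vi => /eqP vi; apply/eqP/matrixP => a b; rewrite !ord1.
  by rewrite colE !mulmxA -colE [LHS]mxE vi mxE.
(* Dividing axis k by the square root of d_k turns the frame matrix into the identity. *)
pose t := \row_k ((Num.sqrt (d k))^-1)%:C : 'rV[R[i]]_3.
pose q' i := nrm2 (v i *m (g *m P *m diag_mx t)).
have q'E i : q' i = \sum_k sqn ((w i *m P) 0 k) / d k.
  apply: eq_bigr => k _; rewrite !mulmxA -/(w i) mul_mx_diag mxE sqnM; congr (_ * _).
  by rewrite mxE sqnR exprVn sqr_sqrtr // ltW.
have q'0 i : 0 <= q' i by apply: nrm2_ge0.
(* This is the trace of that identity matrix: each of the three axes contributes 1. The mean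
   entering AM-GM is thus 3/N. *)
have q'q : \sum_i q' i / q i = 3.
  under eq_bigr => i _ do rewrite q'E mulr_suml.
  rewrite exchange_big (eq_bigr (fun _ => 1)) => [|k _].
    by rewrite sumr_const card_ord.
  rewrite -[RHS](divff (lt0r_neq0 (d0 k))) [X in _ = X / _]dE mulr_suml.
  by apply: eq_big => [i|i _]; rewrite ?in_setT //; field; rewrite qn0 gt_eqF.
have amgm : \prod_i q' i <= (3 / N%:R) ^+ N * \prod_i q i.
  have := leif_AGM (A := I) (E := fun i => q' i / q i) _.
  rewrite q'q big_split prodfV /= => /(_ _)[|h _].
    by move=> i _; rewrite divr_ge0 // ltW.
  by rewrite -ler_pdivrMr ?prodr_gt0.
have detP : sqn (\det P) = 1.
  apply: complexI; rewrite sqnE.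
  by have := congr1 determinant (unitarymxP Pu); rewrite det_mulmx det_map_mx det_tr det1.
have prodd : \prod_k d k <= ((N%:R ^+ 2 - s) / 2) ^+ 2 / (3 * N%:R).
  rewrite !big_ord_recl big_ord0 mulr1 mulrA; apply: newton3 => //.
  - by rewrite -dsum !big_ord_recl big_ord0; ring.
  - by move: dsum2; rewrite !big_ord_recl big_ord0 addr0 addrA.
have prodd0 : 0 < \prod_k d k by apply: prodr_gt0.
have := hc (g *m P *m diag_mx t).
rewrite !det_mulmx det_diag !sqnM detP mulr1.
have -> : sqn (\prod_i t 0 i) = (\prod_k d k)^-1.
  rewrite (big_morph _ sqnM sqn1) -prodfV; apply: eq_bigr => k _.
  by rewrite mxE sqnR exprVn sqr_sqrtr // ltW.
rewrite exprMn exprVn mulrA ler_pdivrMr ?exprn_gt0 // => /le_trans; apply.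
rewrite !prodrXl.
set Q' := \prod_i nrm2 _; set Q := \prod_i nrm2 (v i *m g).
have Q0 : 0 <= Q by apply: prodr_ge0 => i _; apply: nrm2_ge0.
have Q'0 : 0 <= Q' by apply: prodr_ge0 => i _; apply: nrm2_ge0.
apply: (@le_trans _ _ (((3 / N%:R) ^+ N * Q) ^+ 3 * (((N%:R ^+ 2 - s) / 2) ^+ 2 / (3 * N%:R)) ^+ N)).
  apply: ler_pM; rewrite ?exprn_ge0 //; first by rewrite ltW.
    by rewrite lerXn2r // nnegrE mulr_ge0 // exprn_ge0 // divr_ge0 // ltW.
  rewrite lerXn2r // nnegrE; first by rewrite ltW.
  by apply: le_trans prodd; rewrite ltW.
(* Per point the factor is (3/N)^3 ((N^2 - s)/2)^2 / (3N) = (3/2 (1 - s/N^2))^2. *)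
rewrite (exprMn 3) -(exprM _ N) mulnC exprM mulrAC -exprMn.
rewrite le_eqVlt; apply/orP; left; apply/eqP; congr (_ ^+ _ * _).
by field; rewrite gt_eqF.
Qed.
End Scaling.

(** * Determinant estimates and greedy weights *)

Lemma finite_pos_lb {R : realDomainType} (T : finType) (F : T -> R) :
  exists2 m, 0 < m & forall t, 0 < F t -> m <= F t.
Proof.
(* The default 1 keeps the minimum positive when no value of [F] is. *)
exists (\big[Num.min/1]_(t | 0 < F t) F t); first exact: lt_bigmin.
by move=> t Ft; apply: bigmin_le_cond.
Qed.

Section Determinant.
Context {R : realType}.

Lemma sqnD_le (x y : R[i]) : sqn (x + y) <= 2 * (sqn x + sqn y).
Proof.
rewrite /sqn; case: x y => [a b] [c d] /=.
by have := sqr_ge0 (a - c); have := sqr_ge0 (b - d); lra.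
Qed.

Lemma sqn_sum_le (J : Type) (s : seq J) (x : J -> R[i]) :
  sqn (\sum_(j <- s) x j) <= 2 ^+ size s * \sum_(j <- s) sqn (x j).
Proof.
elim: s => [|j s IHs]; first by rewrite !big_nil mulr0 /sqn /= expr0n addr0.
rewrite !big_cons /= exprS; apply: le_trans (sqnD_le _ _) _.
rewrite -mulrA ler_pM2l // mulrDr; apply: lerD => //.
by rewrite ler_peMl ?sqn_ge0 // exprn_ege1 // ler1n.
Qed.

Lemma sqn_le_nrm2 n (u : 'rV[R[i]]_n) k : sqn (u 0 k) <= nrm2 u.
Proof.
by rewrite /nrm2 (bigD1 k) //= lerDl sumr_ge0 // => l _; apply: sqn_ge0.
Qed.

(** A crude Hadamard bound from the Leibniz expansion: each entry of a row is at most the norm of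
    the row. Only the positivity of [K] matters later. *)
Lemma sqn_det_le n : exists2 K : R, 0 < K &
  forall A : 'M[R[i]]_n, sqn (\det A) <= K * \prod_i nrm2 (row i A).
Proof.
exists (2 ^+ size (index_enum {perm 'I_n}) *+ #|{perm 'I_n}|) => [|A].
  by rewrite pmulrn_rgt0 ?exprn_gt0 //; apply/card_gt0P; exists 1%g.
apply: le_trans (sqn_sum_le _ _) _.
rewrite mulrnAl -mulrnAr ler_pM2l ?exprn_gt0 //.
rewrite -sumr_const; apply: ler_sum => s _; rewrite sqnM.
have -> : sqn ((-1 : R[i]) ^+ s) = 1.
  have sqnN1 : sqn (-1 : R[i]) = 1 by rewrite /sqn /= oppr0 sqrrN expr1n expr0n addr0.
  by case: (odd_perm s); rewrite ?expr0 ?sqn1 ?expr1.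
rewrite mul1r (big_morph _ (@sqnM R) (@sqn1 R)); apply: ler_prod => i _.
by rewrite sqn_ge0 /= (le_trans _ (sqn_le_nrm2 _ (s i))) // mxE.
Qed.

Definition rows3 (T : Type) (a b c : 'rV[T]_3) : 'M[T]_3 :=
  \matrix_(r < 3) (if r == 0 :> nat then a else if r == 1 :> nat then b else c).

Lemma rows3M (a b c : 'rV[R[i]]_3) (g : 'M[R[i]]_3) :
  rows3 a b c *m g = rows3 (a *m g) (b *m g) (c *m g).
Proof. by apply/row_matrixP => r; rewrite row_mul !rowK; do 2?case: ifP. Qed.

Lemma prod_rows3 (F : 'rV[R[i]]_3 -> R) a b c :
  \prod_r F (row r (rows3 a b c)) = F a * F b * F c.
Proof. by rewrite !big_ord_recl big_ord0 !rowK /= mulr1 mulrA. Qed.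

End Determinant.

(** Both sides have total degree 3N. Going from left to right, exponent moves from smaller to larger
    numbers: N - 3 from [a] to [b], then t = 2N - 3m from [b] to [c]. The bound 3m <= 2N is what
    makes t nonnegative. *)
Lemma greedy_weights {R : realDomainType} (N m : nat) (a b c : R) :
  (2 <= m)%N -> (3 * m <= 2 * N)%N -> 0 <= a -> a <= b -> b <= c ->
  (a * b * c) ^+ N <= (a * b ^+ m.-1 * c ^+ (N - m)) ^+ 3.
Proof.
move=> m2 mN a0 ab bc; have b0 := le_trans a0 ab; have c0 := le_trans b0 bc.
have [t tE] : exists t, (2 * N = 3 * m + t)%N by exists (2 * N - 3 * m)%N; lia.
rewrite !exprMn -!exprM.
have -> : ((N - m) * 3 = N + t)%N by lia.
have -> : a ^+ N = a ^+ 3 * a ^+ (N - 3) by rewrite -exprD subnKC //; lia.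
rewrite (exprD c).
have : 0 <= a ^+ 3 by apply: exprn_ge0.
move: (a ^+ 3) => a3 a30.
apply: (@le_trans _ _ (a3 * (b ^+ (N - 3) * b ^+ N * c ^+ N))).
  rewrite -!mulrA ler_wpM2l ?exprn_ge0 // ler_wpM2r ?mulr_ge0 ?exprn_ge0 //.
  by rewrite lerXn2r // nnegrE.
rewrite -[X in _ <= X]mulrA ler_wpM2l ?exprn_ge0 //.
rewrite -exprD (_ : N - 3 + N = m.-1 * 3 + t)%N; last by lia.
rewrite exprD -mulrA ler_wpM2l ?exprn_ge0 // mulrC ler_wpM2l ?exprn_ge0 //.
by rewrite lerXn2r // nnegrE.
Qed.

(** * Langer's inequality *)

Section Pairs.
Context (I : finType) (L : {set {set I}}).

Definition linear_space :=
  (forall i j, i != j -> exists2 l, l \in L & (i \in l) && (j \in l)) /\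
  (forall l l' i j, l \in L -> l' \in L -> i != j ->
     i \in l -> j \in l -> i \in l' -> j \in l' -> l = l').

(** Each ordered pair of distinct points is counted on the unique line joining it. *)
Lemma sum_pairs (V : nmodType) (f : I -> I -> V) : linear_space ->
  \sum_i \sum_(j | j != i) f i j =
  \sum_(l in L) \sum_(i in l) \sum_(j in l | j != i) f i j.
Proof.
move=> [Lex Luniq].
transitivity (\sum_(l in L) \sum_i \sum_(j | j != i)
    if (i \in l) && (j \in l) then f i j else 0); last first.
  apply: eq_bigr => l _; rewrite [RHS]big_mkcond; apply: eq_bigr => i _.
  case: ifP => il; last by rewrite big1 // => j _; rewrite andFb.
  by rewrite -big_mkcondr; apply: eq_bigl => j; rewrite andbC.
rewrite exchange_big; apply: eq_bigr => i _.
rewrite exchange_big; apply: eq_bigr => j ji /=.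
have ij : i != j by rewrite eq_sym.
have [l lL /andP[il jl]] := Lex i j ij.
rewrite (bigD1 l) //= il jl big1 ?addr0 // => l' /andP[l'L l'l].
case: ifP => // /andP[il' jl'].
by rewrite (Luniq _ _ _ _ l'L lL ij) ?eqxx in l'l.
Qed.
End Pairs.

Section Langer.
Context {R : realType} (I : finType) (v : I -> 'rV[R[i]]_3) (L : {set {set I}}).
Context (Lls : linear_space L).
Context (Ldet : forall l i j k, l \in L -> i \in l -> j \in l -> i != j ->
  (k \in l) = (\det (rows3 (v i) (v j) (v k)) == 0)).
Context (Lnull : forall l, l \in L ->
  exists2 c : 'cV[R[i]]_3, c != 0 & forall i, i \in l -> v i *m c = 0).
Context (Lcard : forall l, l \in L -> (3 * #|l| <= 2 * #|I|)%N).
Context (I3 : (3 <= #|I|)%N).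

Lemma det_rows3_null (a b c : 'rV[R[i]]_3) (x : 'cV[R[i]]_3) : x != 0 ->
  a *m x = 0 -> b *m x = 0 -> c *m x = 0 -> \det (rows3 a b c) = 0.
Proof.
move=> x0 ax bx cx; apply/eqP; apply/negPn; apply: contra x0; rewrite -unitfE => du.
have {}du : rows3 a b c \in unitmx by rewrite unitmxE.
rewrite -[x](mulKmx du).
suff -> : rows3 a b c *m x = 0 by rewrite mulmx0.
by apply/row_matrixP => r; rewrite row_mul rowK row0; do 2?case: ifP.
Qed.

Lemma exists_triangle : exists i j k, \det (rows3 (v i) (v j) (v k)) != 0.
Proof.
have /card_gt1P[i [j [_ _ ij]]] : (1 < #|I|)%N by apply: leq_trans I3.
have [l lL /andP[il jl]] := Lls.1 i j ij.
have /subsetPn[k _ kl] : ~~ ([set: I] \subset l).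
  apply/negP => /subset_leq_card; rewrite cardsT => h.
  by have := Lcard lL; have := I3; lia.
by exists i, j, k; rewrite -(Ldet _ lL il jl ij).
Qed.

Lemma points_span (x : 'cV[R[i]]_3) : x != 0 -> exists i, v i *m x != 0.
Proof.
move=> x0; have [i vi|v0] := pickP (fun i => v i *m x != 0); first by exists i.
have {}v0 i : v i *m x = 0 by apply/eqP; have := v0 i; move/negbFE.
have [i [j [k]]] := exists_triangle.
by rewrite (det_rows3_null x0) ?eqxx.
Qed.

(** If v_i were zero, every determinant containing it would vanish, and a line through i would
    contain all points. *)
Lemma points_neq0 i : v i != 0.
Proof.
apply/eqP => vi; have [j ij] : exists j, j != i.
  have /card_gt1P[j [k [_ _ jk]]] : (1 < #|I|)%N by apply: leq_trans I3.
  by have [<-|] := eqVneq j i; [exists k; rewrite eq_sym|exists j].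
have [l lL /andP[jl il]] := Lls.1 j i ij.
have /subsetPn[k _ /negP[]] : ~~ ([set: I] \subset l).
  apply/negP => /subset_leq_card; rewrite cardsT => h.
  by have := Lcard lL; have := I3; lia.
rewrite (Ldet _ lL jl il ij) vi (expand_det_row _ (Ordinal (isT : 1 < 3)%N)) big1 // => c _.
by rewrite mxE /= mxE mul0r.
Qed.

(** Given [g], choose i1 of least norm, i2 of least norm among the rest, and i3 of least norm off
    the line i1 i2. Their determinant is nonzero, hence at least [m], one of finitely many values
    independent of [g]. Hadamard then bounds the product of the three norms below, and
    [greedy_weights] passes to all points. *)
Lemma exists_scaling_bound : exists2 c : R, 0 < c & scaling_bound v c.
Proof.
have [K K0 hK] := @sqn_det_le R 3.
have [m m0 hm] := finite_pos_lb (fun t : I * I * I =>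
  sqn (\det (rows3 (v t.1.1) (v t.1.2) (v t.2)))).
have {}hm i j k : \det (rows3 (v i) (v j) (v k)) != 0 ->
    m <= sqn (\det (rows3 (v i) (v j) (v k))).
  by move=> D0; apply: (hm (i, j, k)); rewrite lt_neqAle sqn_ge0 andbT eq_sym sqn_eq0.
exists ((m / K) ^+ #|I|) => [|g]; first by rewrite exprn_gt0 // divr_gt0.
have [q qE q0] : exists2 q : I -> R, forall i, nrm2 (v i *m g) = q i & forall i, 0 <= q i.
  by exists (fun i => nrm2 (v i *m g)) => // i; apply: nrm2_ge0.
under eq_bigr do rewrite qE.
rewrite -exprMn.
have [i0 _] : exists i0 : I, true by apply/card_gt0P/(leq_trans _ I3).
have [i1 _ q1] := arg_minP q (isT : xpredT i0).
have [j0 j01] : exists j0, j0 != i1.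
  have /card_gt1P[j [k [_ _ jk]]] : (1 < #|I|)%N by apply: leq_trans I3.
  by have [<-|] := eqVneq j i1; [exists k; rewrite eq_sym|exists j].
have [i2 i21 q2] := arg_minP q (j01 : (fun j => j != i1) j0).
have [l lL /andP[l2 l1]] := Lls.1 i2 i1 i21.
have [k0 k0l] : exists k0, k0 \notin l.
  have /subsetPn[k _ kl] : ~~ ([set: I] \subset l); last by exists k.
  apply/negP => /subset_leq_card; rewrite cardsT => h.
  by have := Lcard lL; have := I3; lia.
have [i3 i3l q3] := arg_minP q (k0l : (fun j => j \notin l) k0).
have i12 : i1 != i2 by rewrite eq_sym.
have D0 : \det (rows3 (v i1) (v i2) (v i3)) != 0 by rewrite -(Ldet _ lL l1 l2 i12).
have q12 : q i1 <= q i2 by apply: q1.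
have q23 : q i2 <= q i3 by apply: q2; apply: contraNneq i3l => ->.
have small : m / K * sqn (\det g) <= q i1 * q i2 * q i3.
  rewrite mulrAC ler_pdivrMr // [X in _ <= X]mulrC.
  apply: le_trans (_ : sqn (\det (rows3 (v i1) (v i2) (v i3))) * sqn (\det g) <= _).
    by apply: ler_wpM2r; [apply: sqn_ge0|apply: hm].
  by rewrite -sqnM -det_mulmx rows3M; apply: le_trans (hK _) _; rewrite prod_rows3 !qE.
have l_gt1 : (2 <= #|l|)%N by apply/card_gt1P; exists i1, i2.
have ms0 : 0 <= m / K * sqn (\det g).
  by rewrite mulr_ge0 ?sqn_ge0 // divr_ge0 // ltW.
apply: le_trans (_ : (q i1 * q i2 * q i3) ^+ #|I| <= _).
  by rewrite lerXn2r // nnegrE ?mulr_ge0.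
apply: le_trans (greedy_weights l_gt1 (Lcard lL) (q0 _) q12 q23) _.
rewrite prodrXl lerXn2r ?nnegrE ?mulr_ge0 ?exprn_ge0 ?prodr_ge0 //.
(* On the line, i1 gives q i1 and each other point at least q i2; each point off the line gives at
   least q i3. *)
rewrite (bigID (mem l)) (bigD1 i1) //=.
apply: ler_pM; rewrite ?mulr_ge0 ?exprn_ge0 //.
  apply: ler_wpM2l => //.
  have -> : #|l|.-1 = #|[pred i in l | i != i1]|.
    by rewrite (cardD1 i1 l) l1 /=; apply: eq_card => i; rewrite !inE andbC.
  rewrite -prodr_const; apply: ler_prod => i /andP[_ ii1].
  by rewrite q0 q2.
have -> : (#|I| - #|l|)%N = #|[pred i | i \notin l]|.
  by rewrite -(cardC (mem l)) addKn; apply: eq_card.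
rewrite -prodr_const; apply: ler_prod => i il.
by rewrite q0 q3.
Qed.

(** The diagonal contributes N. The points of a line span at most a plane, so
    [planar_frame_potential] gives s^2/2 for all ordered pairs on it, of which the s diagonal ones
    are removed. *)
Lemma frame_potential_ge g : g \in unitmx ->
  #|I|%:R + \sum_(l in L) (#|l|%:R ^+ 2 / 2 - #|l|%:R) <= frame_potential v g.
Proof.
move=> gu; rewrite /frame_potential.
set f := fun i j => (nrm2 (v i *m g))^-1 * (nrm2 (v j *m g))^-1 *
    sqn (dotc (v i *m g) (v j *m g)).
have q0 i : nrm2 (v i *m g) != 0.
  rewrite nrm2_eq0; apply: contra (points_neq0 i) => /eqP vg.
  by rewrite -[v i](mulmxK gu) vg mul0mx.
have f1 i : f i i = 1.
  by rewrite /f -nrm2E sqnR; field; rewrite q0.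
rewrite -/f; have -> : \sum_i \sum_j f i j = #|I|%:R + \sum_i \sum_(j | j != i) f i j.
  rewrite -sum1_card natr_sum -big_split /=; apply: eq_bigr => i _.
  by rewrite (bigD1 i) //= f1.
rewrite lerD2l (sum_pairs _ Lls); apply: ler_sum => l lL.
have -> : \sum_(i in l) \sum_(j in l | j != i) f i j =
    \sum_(i in l) \sum_(j in l) f i j - #|l|%:R.
  apply/eqP; rewrite eq_sym subr_eq -sum1_card natr_sum -big_split /=; apply/eqP.
  by apply: eq_bigr => i il; rewrite [LHS](bigD1 i) //= f1 addrC.
rewrite lerD2r ler_pdivrMr // mulrC.
have [c c0 vc] := Lnull lL.
have c'0 : invmx g *m c != 0.
  by apply: contra c0 => /eqP gc; rewrite -[c](mulKVmx gu) gc mulmx0.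
have := @planar_frame_potential _ _ l (fun i => (nrm2 (v i *m g))^-1) (fun i => v i *m g) _ c'0.
rewrite (eq_bigr (fun _ => 1)) => [|i _]; last by rewrite mulVf.
rewrite sumr_const; apply => i il.
by rewrite mulmxA mulmxK // vc.
Qed.

(** A violation forces every frame potential above N^2/3 by a fixed amount, so every scaling bound
    could be enlarged by a fixed factor. This contradicts the finiteness of their supremum. *)
Theorem langer_inequality :
  3 * \sum_(l in L) (#|l|%:R * (#|l|%:R - 2)) <= 2 * #|I|%:R * (#|I|%:R - 3) :> R.
Proof.
rewrite leNgt; apply/negP => viol.
set N : R := #|I|%:R in viol.
have N0 : 0 < N by rewrite ltr0n; lia.
(* Capping at N^2 keeps 1 - s/N^2 nonnegative, so that s > N^2/3 puts 3/2 (1 - s/N^2) in [0, 1). *)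
pose s := Order.min (N + \sum_(l in L) (#|l|%:R ^+ 2 / 2 - #|l|%:R)) (N ^+ 2).
have s_gt : N ^+ 2 / 3 < s.
  rewrite lt_min; apply/andP; split; last by have := mulr_gt0 N0 N0; rewrite expr2; lra.
  have -> : \sum_(l in L) (#|l|%:R ^+ 2 / 2 - #|l|%:R) =
     (\sum_(l in L) (#|l|%:R * (#|l|%:R - 2))) / 2 :> R.
    by rewrite mulr_suml; apply: eq_bigr => l _; field.
  lra.
have s_le : s <= N ^+ 2 by rewrite ge_min lexx orbT.
(* The midpoint between the contraction factor and 1 stays positive even if that factor is 0, so
   dividing by it is safe. *)
pose rho := (1 + ((3 / 2 * (1 - s / N ^+ 2)) ^+ 2) ^+ #|I|) / 2.
have K1 : ((3 / 2 * (1 - s / N ^+ 2)) ^+ 2) ^+ #|I| < 1.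
  have u1 : 1 / 3 < s / N ^+ 2 by rewrite ltr_pdivlMr ?exprn_gt0 //; lra.
  have u2 : s / N ^+ 2 <= 1 by rewrite ler_pdivrMr ?exprn_gt0 // mul1r.
  by rewrite -exprM exprn_ilt1 //; [lia|lra|lra].
have K0 : 0 <= ((3 / 2 * (1 - s / N ^+ 2)) ^+ 2) ^+ #|I| by rewrite exprn_ge0 // sqr_ge0.
have rho0 : 0 < rho by rewrite /rho; lra.
have rho1 : rho < 1 by rewrite /rho; lra.
have Krho : ((3 / 2 * (1 - s / N ^+ 2)) ^+ 2) ^+ #|I| <= rho by rewrite /rho; lra.
have improve c : 0 <= c -> scaling_bound v c -> scaling_bound v (c / rho).
  move=> c0 hc g; rewrite mulrAC ler_pdivrMr // [X in _ <= X]mulrC.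
  have P0 : 0 <= \prod_i nrm2 (v i *m g) ^+ 3.
    by apply: prodr_ge0 => i _; rewrite exprn_ge0 ?nrm2_ge0.
  have [gu|] := boolP (g \in unitmx); last first.
    rewrite unitmxE unitfE negbK => /eqP ->.
    have -> : sqn (0 : R[i]) = 0 by apply/eqP; rewrite sqn_eq0.
    by rewrite expr0n gtn_eqF ?(leq_trans _ I3) // mulr0 mulr_ge0 // ltW.
  apply: le_trans (scaling_step (s := s) _ c0 _ _ gu _ hc) _ => //.
  - exact: leq_trans I3.
  - exact: points_neq0.
  - exact: points_span.
  - by apply: le_trans (frame_potential_ge gu); rewrite ge_min lexx.
  - exact: ler_wpM2r.
have [c0 c00 hc0] := exists_scaling_bound.
have hsup : classical_sets.has_sup (scaling_bound v).
  split; first by exists c0.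
  exists (\prod_i nrm2 (v i *m 1%:M) ^+ 3) => c /(_ 1%:M).
  by rewrite det1 sqn1 expr1n mulr1.
have S0 : c0 <= sup (scaling_bound v) by apply: ub_le_sup => //; apply: hsup.2.
(* A bound c > rho * sup exists, and then c / rho is a scaling bound exceeding the supremum. *)
have [|c hc] := sup_adherent (eps := (1 - rho) * sup (scaling_bound v)) _ hsup.
  by rewrite mulr_gt0 //; lra.
have -> x : x - (1 - rho) * x = rho * x by ring.
move=> c_gt; have c_gt0 : 0 < c.
  by apply: lt_trans c_gt; rewrite mulr_gt0 //; apply: lt_le_trans S0.
have := ub_le_sup hsup.2 (improve c (ltW c_gt0) hc).
by rewrite ler_pdivrMr // mulrC leNgt c_gt.
Qed.
End Langer.

(** * Hirzebruch's inequality and the colour count *)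

(** Each side sums g i * h j over ordered pairs of distinct points, on the left line by line. It is
    used below with constants, indicators and colour signs. *)
Lemma pair_sum {R : comPzRingType} (I : finType) (L : {set {set I}}) (g h : I -> R) :
  linear_space L ->
  \sum_(l in L) ((\sum_(i in l) g i) * (\sum_(i in l) h i) - \sum_(i in l) g i * h i) =
  (\sum_i g i) * (\sum_i h i) - \sum_i g i * h i.
Proof.
have pairs (P : pred I) : \sum_(i | P i) \sum_(j | P j && (j != i)) g i * h j =
    (\sum_(i | P i) g i) * (\sum_(i | P i) h i) - \sum_(i | P i) g i * h i.
  apply/eqP; rewrite eq_sym subr_eq big_distrlr -big_split /=; apply/eqP.
  by apply: eq_bigr => i Pi; rewrite (bigD1 i) //= addrC.
by move=> Lls; rewrite -(pairs xpredT) (sum_pairs _ Lls); apply: eq_bigr => l _; rewrite pairs.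
Qed.

(* The coefficient of [t_s] in Hirzebruch's inequality
   [t_2 + t_3 >= N + \sum_(s > 4) (s - 4) t_s]. *)
Definition hirzebruch_weight {R : pzRingType} (s : nat) : R := 4 - s%:R - (s == 2)%:R.

(** The right side minus the left is (s - 4)^2 - 4 [s = 2], with equality at s = 2 and s = 4. *)
Lemma hirzebruch_weight_stable {R : realDomainType} (s : nat) : (2 <= s)%N ->
  s%:R * (4 - s%:R) <= 4 * hirzebruch_weight s :> R.
Proof.
rewrite /hirzebruch_weight; case: s => [|[|[|[|s]]]] //= _; first by lra.
  by lra.
rewrite subr0; have -> : s.+4%:R = s%:R + 4 :> R by rewrite -addn4 natrD.
have : 0 <= s%:R :> R by [].
by nra.
Qed.

(** Here a line other than the long one has [a] points on the long line and [r] off it. The left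
    side is chosen because its sum over lines is an exact pair count. For a = 1 the difference is (r
    - 2)(r - 3) - 2 [r = 1]. *)
Lemma hirzebruch_weight_pencil {R : realDomainType} (a r : nat) :
  (a <= 1)%N -> (2 <= a + r)%N ->
  2 * (a * r)%:R - (r%:R ^+ 2 - r%:R) <= 2 * hirzebruch_weight (a + r) :> R.
Proof.
rewrite /hirzebruch_weight; case: a => [|[|//]] _.
  rewrite mul0n add0n; case: r => [|[|[|r]]] //= _; first by lra.
  have -> : r.+3%:R = r%:R + 3 :> R by rewrite -addn3 natrD.
  have : 0 <= r%:R :> R by [].
  by nra.
rewrite mul1n add1n; case: r => [|[|[|r]]] //= _; first by lra.
  by lra.
have -> : r.+4%:R = r%:R + 4 :> R by rewrite -addn4 natrD.
have -> : r.+3%:R = r%:R + 3 :> R by rewrite -addn3 natrD.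
have : 0 <= r%:R :> R by [].
by nra.
Qed.

Lemma hirzebruch_of_long_line {R : realFieldType} (I : finType) (L : {set {set I}}) (l0 : {set I}) :
  linear_space L -> (forall l, l \in L -> 2 <= #|l|)%N -> l0 \in L ->
  (#|l0| + 2 <= #|I|)%N -> (2 * #|I| < 3 * #|l0|)%N ->
  #|I|%:R <= \sum_(l in L) hirzebruch_weight #|l| :> R.
Proof.
move=> Lls L2 l0L q2 m23.
(* With m points on [l0] and q off it, the g-h pairs number m q and the h-h pairs q (q - 1). *)
pose g i : R := (i \in l0)%:R; pose h i : R := (i \notin l0)%:R.
have gl (l : {set I}) : \sum_(i in l) g i = #|l :&: l0|%:R.
  rewrite -sum1_card natr_sum [RHS]big_mkcond [LHS]big_mkcond.
  by apply: eq_bigr => i _; rewrite inE /g; case: (i \in l) => //; case: (i \in l0).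
have hl (l : {set I}) : \sum_(i in l) h i = #|l :\: l0|%:R.
  rewrite -sum1_card natr_sum [RHS]big_mkcond [LHS]big_mkcond.
  by apply: eq_bigr => i _; rewrite inE /h andbC; case: (i \in l) => //; case: (i \in l0).
have gh i : g i * h i = 0 by rewrite /g /h; case: (i \in l0); rewrite ?mulr0 ?mul0r.
have hh i : h i * h i = h i by rewrite /h; case: (i \in l0); rewrite ?mulr0 ?mulr1.
have gT : \sum_i g i = #|l0|%:R.
  by have := gl setT; rewrite setTI => <-; apply: eq_bigl => i; rewrite in_setT.
have hT : \sum_i h i = #|I|%:R - #|l0|%:R.
  transitivity (\sum_(i in setT) h i); first by apply: eq_bigl => i; rewrite in_setT.
  by rewrite hl setTD -[X in X%:R - _](cardsC l0) natrD addrAC subrr add0r.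
have sum_r : \sum_(l in L) (#|l :\: l0|%:R ^+ 2 - #|l :\: l0|%:R) =
    (#|I|%:R - #|l0|%:R) ^+ 2 - (#|I|%:R - #|l0|%:R) :> R.
  rewrite -hT expr2 -[X in _ = _ - X](eq_bigr _ (fun i _ => hh i)) -(pair_sum h h Lls).
  by apply: eq_bigr => l _; rewrite hl (eq_bigr _ (fun i _ => hh i)) hl expr2.
have sum_ar : \sum_(l in L) (#|l :&: l0| * #|l :\: l0|)%:R =
    #|l0|%:R * (#|I|%:R - #|l0|%:R) :> R.
  have gh0 : \sum_i g i * h i = 0 by rewrite big1.
  rewrite -hT -gT -[RHS]subr0 -[X in _ = _ - X]gh0 -(pair_sum g h Lls).
  by apply: eq_bigr => l _; rewrite natrM gl hl (eq_bigr _ (fun i _ => gh i)) big1_eq subr0.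
have l0D : #|l0 :\: l0| = 0%N by rewrite setDv cards0.
move: sum_r sum_ar; rewrite !(bigD1 (P := mem L) l0) //= l0D muln0 expr0n subr0 !add0r.
set sr := \sum_(i | _) _; move=> sum_r.
set sar := \sum_(i | _) _; move=> sum_ar.
set sw := \sum_(i | _) _.
have le_sum : 2 * sar - sr <= 2 * sw.
  rewrite /sar /sr /sw !mulr_sumr -sumrB; apply: ler_sum => l /andP[lL l_l0].
  rewrite -(cardsID l0 l); apply: hirzebruch_weight_pencil; last by rewrite cardsID L2.
  rewrite leqNgt; apply: contra l_l0 => /card_gt1P[i [j [/setIP[il il0] /setIP[jl jl0] ij]]].
  by rewrite (Lls.2 _ _ _ _ lL l0L ij).
have [q Iq] : exists q, #|I| = (#|l0| + q)%N by exists (#|I| - #|l0|)%N; lia.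
move: sum_r sum_ar q2 m23; rewrite /hirzebruch_weight Iq; move: #|l0| => m.
rewrite natrD addrAC subrr add0r leq_add2l => sum_r sum_ar q2 m23.
(* It remains to show m q - q (q - 1)/2 + (4 - m) >= m + q. Writing q = u + 2 and m = 2q + 1 + t
   makes all hypotheses nonnegativity conditions. *)
have [u uE] : exists u, q = u.+2 by exists (q - 2)%N; lia.
have [t tE] : exists t, m = (2 * q + 1 + t)%N by exists (m - (2 * q + 1))%N; lia.
have -> : (m == 2) = false by lia.
subst m; subst q; move: sum_r sum_ar.
rewrite subr0 !natrD !natrM -[u.+2]addn2 !natrD => sum_r sum_ar.
have u0 : 0 <= u%:R :> R by [].
have t0 : 0 <= t%:R :> R by [].
have := mulr_ge0 u0 t0; have := mulr_ge0 u0 u0.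
by nra.
Qed.

(** With s = i + j and d = i - j the left side is 8 - s - d^2 - 2 [s = 2]. It is nonpositive for s
    >= 8, and also for s = 7 since d is then odd; this is where the limit of six points comes from.
    Smaller cases are checked one by one. *)
Lemma equichromatic_weight {R : realFieldType} (i j : nat) : (2 <= i + j)%N ->
  (i + j)%:R - (i%:R - j%:R) ^+ 2 + 2 * hirzebruch_weight (i + j) <=
  4 * ((i + j <= 6)%N && equichromatic 1 i j)%:R :> R.
Proof.
rewrite /equichromatic /hirzebruch_weight => s2.
have [s8|] := leqP 8 (i + j).
  apply: (@le_trans _ _ 0); last by case: [&& _, _, _ & _]; rewrite ?mulr0 ?mulr1.
  have -> : (i + j == 2) = false by lia.
  rewrite subr0; have : 8%:R <= (i + j)%:R :> R by rewrite ler_nat.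
  by have := sqr_ge0 (i%:R - j%:R : R); lra.
by move: i j s2 => [|[|[|[|[|[|[|[|i]]]]]]]] [|[|[|[|[|[|[|[|j]]]]]]]] //= _ _; lra.
Qed.

Theorem hirzebruch_inequality {R : realType} (I : finType) (v : I -> 'rV[R[i]]_3)
    (L : {set {set I}}) :
  linear_space L ->
  (forall l i j k, l \in L -> i \in l -> j \in l -> i != j ->
     (k \in l) = (\det (rows3 (v i) (v j) (v k)) == 0)) ->
  (forall l, l \in L ->
     exists2 c : 'cV[R[i]]_3, c != 0 & forall i, i \in l -> v i *m c = 0) ->
  (3 <= #|I|)%N -> (forall l, l \in L -> 2 <= #|l| /\ #|l| + 2 <= #|I|)%N ->
  #|I|%:R <= \sum_(l in L) hirzebruch_weight #|l| :> R.
Proof.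
move=> Lls Ldet Lnull I3 Lcard.
have L2 l : l \in L -> (2 <= #|l|)%N by move=> /Lcard[].
have [l0 /andP[l0L l0long]|short] := pickP (fun l => (l \in L) && (2 * #|I| < 3 * #|l|)%N).
  by apply: (hirzebruch_of_long_line Lls L2 l0L) l0long; have [] := Lcard _ l0L.
have Lshort l : l \in L -> (3 * #|l| <= 2 * #|I|)%N.
  by move=> lL; rewrite leqNgt; have := short l; rewrite lL /= => ->.
have langer := langer_inequality Lls Ldet Lnull Lshort I3.
have := pair_sum (fun=> 1 : R) (fun=> 1) Lls.
under eq_bigr => l _ do rewrite mulr1 !sumr_const.
rewrite mulr1 !sumr_const => pairs.
have : \sum_(l in L) #|l|%:R * (4 - #|l|%:R) <= 4 * \sum_(l in L) hirzebruch_weight #|l| :> R.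
  by rewrite mulr_sumr; apply: ler_sum => l lL; apply: hirzebruch_weight_stable; apply: L2.
(* By pair counting and Langer's inequality the right side is at least 2N(N - 1) - 2N(N - 3) =
   4N. *)
have -> : \sum_(l in L) #|l|%:R * (4 - #|l|%:R) =
    2 * \sum_(l in L) (#|l|%:R * #|l|%:R - #|l|%:R) -
    3 * \sum_(l in L) (#|l|%:R * (#|l|%:R - 2)) :> R.
  by rewrite !mulr_sumr -sumrB; apply: eq_bigr => l _; ring.
rewrite pairs; move: langer; set X := 3 * _; move: #|I|%:R => N.
by nra.
Qed.

Lemma equichromatic_count {R : realFieldType} (I : finType) (L : {set {set I}}) (G : {set I}) :
  linear_space L -> (forall l, l \in L -> 2 <= #|l|)%N ->
  #|I|%:R <= \sum_(l in L) hirzebruch_weight #|l| :> R ->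
  3 * #|I|%:R - (#|G|%:R - #|~: G|%:R) ^+ 2 <=
  4 * #|[set l in L | (#|l| <= 6)%N && equichromatic 1 #|l :&: G| #|l :\: G|]|%:R :> R.
Proof.
move=> Lls L2 hirz.
(* With signs for colours, [pair_sum] counts monochromatic minus bichromatic pairs. *)
pose c i : R := if i \in G then 1 else -1.
have cc i : c i * c i = 1 by rewrite /c; case: ifP; rewrite ?mulr1 // mulrNN mulr1.
have cl (l : {set I}) : \sum_(i in l) c i = #|l :&: G|%:R - #|l :\: G|%:R.
  rewrite (bigID (mem G)) /=; congr (_ + _).
    rewrite (eq_bigr (fun=> 1)) => [|i /andP[_ iG]]; last by rewrite /c iG.
    by rewrite sumr_const; congr (_%:R); apply: eq_card => i; rewrite !inE.
  rewrite (eq_bigr (fun=> -1)) => [|i /andP[_ /negbTE iG]]; last by rewrite /c iG.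
  rewrite sumr_const mulNrn; congr (- _%:R); apply: eq_card => i.
  by rewrite !inE andbC.
have := pair_sum c c Lls.
have -> : \sum_i c i = #|G|%:R - #|~: G|%:R.
  transitivity (\sum_(i in [set: I]) c i); first by apply: eq_bigl => i; rewrite in_setT.
  by rewrite cl setTI setTD.
rewrite [X in _ = _ - X](eq_bigr _ (fun i _ => cc i)) sumr_const.
under eq_bigr => l _ do rewrite cl (eq_bigr _ (fun i _ => cc i)) sumr_const.
move=> colours.
have -> : #|[set l in L | (#|l| <= 6)%N && equichromatic 1 #|l :&: G| #|l :\: G|]|%:R =
   \sum_(l in L) ((#|l| <= 6)%N && equichromatic 1 #|l :&: G| #|l :\: G|)%:R :> R.
  rewrite -sum1_card natr_sum (eq_bigl _ _ (fun l => in_set _ l)) big_mkcondr.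
  by apply: eq_bigr => l _; case: (_ && _).
have : \sum_(l in L) (#|l|%:R - (#|l :&: G|%:R - #|l :\: G|%:R) ^+ 2 + 2 * hirzebruch_weight #|l|) <=
   4 * \sum_(l in L) ((#|l| <= 6)%N && equichromatic 1 #|l :&: G| #|l :\: G|)%:R :> R.
  rewrite mulr_sumr; apply: ler_sum => l lL.
  by rewrite -[#|l|](cardsID G); apply: equichromatic_weight; rewrite cardsID L2.
rewrite big_split /= -mulr_sumr.
have -> : \sum_(l in L) (#|l|%:R - (#|l :&: G|%:R - #|l :\: G|%:R) ^+ 2) =
    - \sum_(l in L) ((#|l :&: G|%:R - #|l :\: G|%:R) * (#|l :&: G|%:R - #|l :\: G|%:R) - #|l|%:R) :> R.
  by rewrite -sumrN; apply: eq_bigr => l _; ring.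
rewrite colours; move: hirz; rewrite expr2; set S := \sum_(l in L) hirzebruch_weight _.
set Y := _ * (_ - _ : R). by lra.
Qed.

(** * Collinearity in homogeneous coordinates *)

Lemma det_mx33 {R : comPzRingType} (F : nat -> nat -> R) :
  \det (\matrix_(i < 3, j < 3) F i j) =
  F 0%N 0%N * (F 1%N 1%N * F 2%N 2%N - F 1%N 2%N * F 2%N 1%N)
  - F 0%N 1%N * (F 1%N 0%N * F 2%N 2%N - F 1%N 2%N * F 2%N 0%N)
  + F 0%N 2%N * (F 1%N 0%N * F 2%N 1%N - F 1%N 1%N * F 2%N 0%N).
Proof.
rewrite (expand_det_row _ ord0) !big_ord_recl big_ord0 /cofactor.
rewrite !(expand_det_row _ ord0) !big_ord_recl !big_ord0 /cofactor !det_mx11 !mxE /=.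
rewrite /bump /= !(add0n, addn0, expr0, expr1) (_ : 1 + 1 = 2)%N // sqrrN.
ring.
Qed.

Section Affine.
Context {R : realType}.
Implicit Types p q r : pt R.

Definition homogeneous p : 'rV[R[i]]_3 :=
  \row_(k < 3) (if k == 0 :> nat then p.1 else if k == 1 :> nat then p.2 else 1).

Lemma det_homogeneous p q r : \det (rows3 (homogeneous p) (homogeneous q) (homogeneous r)) =
  (q.1 - p.1) * (r.2 - p.2) - (r.1 - p.1) * (q.2 - p.2).
Proof.
pose F (i j : nat) := let a := if i == 0 then p else if i == 1 then q else r in
  if j == 0 then a.1 else if j == 1 then a.2 else 1 : R[i].
have -> : rows3 (homogeneous p) (homogeneous q) (homogeneous r) =
    \matrix_(i < 3, j < 3) F i j.
  by apply/matrixP => i j; rewrite !mxE /F; case: eqP => _; last case: eqP => _; rewrite mxE.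
rewrite det_mx33 /F /=; ring.
Qed.

(** The nonzero vector q - p is annihilated by the nonzero form (a, b), so r - p is annihilated
    exactly when it is parallel to q - p. Each direction cancels a nonzero coordinate, of (a, b) or
    of q - p. *)
Lemma on_line_det a b c p q r : is_line a b -> p != q -> on_line a b c p -> on_line a b c q ->
  on_line a b c r = (\det (rows3 (homogeneous p) (homogeneous q) (homogeneous r)) == 0).
Proof.
rewrite det_homogeneous /on_line => ab pq /eqP hp /eqP hq.
have hu : a * (q.1 - p.1) + b * (q.2 - p.2) = 0.
  by rewrite !mulrBr addrACA -opprD hp hq subrr.
have -> : (a * r.1 + b * r.2 == c) = (a * (r.1 - p.1) + b * (r.2 - p.2) == 0).
  by rewrite !mulrBr addrACA -opprD hp subr_eq0.
have : (q.1 - p.1 != 0) || (q.2 - p.2 != 0).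
  rewrite -negb_and !subr_eq0; apply: contra pq => /andP[/eqP e1 /eqP e2].
  by rewrite (surjective_pairing p) (surjective_pairing q) e1 e2.
move: hu; set u1 := q.1 - p.1; set u2 := q.2 - p.2; set w1 := r.1 - p.1; set w2 := r.2 - p.2.
move=> hu u0; apply/eqP/eqP => [hw|D].
  case/orP: ab => [a0|b0].
    apply: (mulfI a0); rewrite mulr0.
    transitivity ((a * u1 + b * u2) * w2 - (a * w1 + b * w2) * u2); first by ring.
    by rewrite hu hw !mul0r subrr.
  apply: (mulfI b0); rewrite mulr0.
  transitivity ((a * w1 + b * w2) * u1 - (a * u1 + b * u2) * w1); first by ring.
  by rewrite hu hw !mul0r subrr.
case/orP: u0 => [u10|u20].
  apply: (mulfI u10); rewrite mulr0.
  transitivity ((a * u1 + b * u2) * w1 + b * (u1 * w2 - w1 * u2)); first by ring.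
  by rewrite hu D mul0r mulr0 addr0.
apply: (mulfI u20); rewrite mulr0.
transitivity ((a * u1 + b * u2) * w2 - a * (u1 * w2 - w1 * u2)); first by ring.
by rewrite hu D mul0r mulr0 subr0.
Qed.
End Affine.

(** * Point sets in the affine plane *)

Local Open Scope fset_scope.

Lemma card_imfset_set (T : finType) (K : choiceType) (f : T -> K) (A : {set T}) :
  injective f -> #|` [fset f x | x in A]| = #|A|.
Proof.
move=> f_inj; rewrite card_imfset // cardE; apply/perm_size/uniq_perm.
- exact: enum_finmem_uniq.
- exact: enum_uniq.
- by move=> x; rewrite !enum_finmemE.
Qed.

Section Traces.
Context {R : realType} (P : {fset pt R}).
Implicit Types l : {set P}.

Definition line_trace l : Prop :=
  exists a b c, is_line a b /\ forall p : P, (p \in l) = on_line a b c (val p).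

(** Lines become subsets of the finite type [P], to which the incidence lemmas apply; [fset_of_set]
    carries them back to sets of points in the plane. *)
Definition traces : {set {set P}} := [set l : {set P} | (1 < #|l|)%N && `[< line_trace l >]].

Lemma trace_det l (i j k : P) : l \in traces -> i \in l -> j \in l -> i != j ->
  (k \in l) = (\det (rows3 (homogeneous (val i)) (homogeneous (val j)) (homogeneous (val k))) == 0).
Proof.
rewrite inE => /andP[_ /asboolP[a [b [c [ab lE]]]]]; rewrite !lE => il jl ij.
by apply: on_line_det il jl.
Qed.

Lemma traces_linear_space : linear_space traces.
Proof.
split=> [i j ij|l l' i j lL l'L ij il jl il' jl']; last first.
  by apply/setP => k; rewrite (trace_det _ lL il jl ij) (trace_det _ l'L il' jl' ij).
pose a := (val j).2 - (val i).2; pose b := (val i).1 - (val j).1.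
pose c := (a * (val i).1 + b * (val i).2)%R.
pose l := [set k : P | on_line a b c (val k)].
have il : i \in l by rewrite inE /on_line.
have jl : j \in l by rewrite inE /on_line /c /a /b; apply/eqP; ring.
exists l; last by rewrite il.
rewrite inE; apply/andP; split; first by apply/card_gt1P; exists i, j.
apply/asboolP; exists a, b, c; split; last by move=> p; rewrite inE.
rewrite /is_line /a /b -negb_and !subr_eq0; apply: contra ij => /andP[/eqP e2 /eqP e1].
by apply/eqP/val_inj; rewrite (surjective_pairing (val i)) (surjective_pairing (val j)) e1 e2.
Qed.

Lemma trace_null l : l \in traces ->
  exists2 x : 'cV[R[i]]_3, x != 0 & forall i, i \in l -> homogeneous (val i) *m x = 0.
Proof.
rewrite inE => /andP[_ /asboolP[a [b [c [ab lE]]]]].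
(* The equation of the line is the pairing of (x, y, 1) with (a, b, -c). *)
pose F (k : nat) := if k == 0 then a else if k == 1 then b else - c.
exists (\col_(k < 3) F k).
  apply: contraTneq ab => /matrixP x0.
  have := x0 ord0 ord0; have := x0 (lift ord0 ord0) ord0.
  by rewrite !mxE /F /= => -> ->; rewrite /is_line eqxx.
move=> i; rewrite lE /on_line => /eqP il.
apply/matrixP => x y; rewrite !mxE !big_ord_recl big_ord0 !mxE /F /= -il; ring.
Qed.

Definition fset_of_set l : {fset pt R} := [fset val p | p in l].

Lemma card_fset_of_set l : #|` fset_of_set l| = #|l|.
Proof. exact/card_imfset_set/val_inj. Qed.

Lemma mem_fset_of_set l (p : P) : (val p \in fset_of_set l) = (p \in l).
Proof. by rewrite mem_imfset //; apply: val_inj. Qed.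

Lemma fset_of_set_sub l : fset_of_set l `<=` P.
Proof. by apply/fsubsetP => p /imfsetP[q _ ->]; apply: valP. Qed.

Lemma fset_of_set_inj : injective fset_of_set.
Proof.
by move=> l l' e; apply/setP => p; rewrite -!mem_fset_of_set e.
Qed.

Lemma fset_of_setI l (A : {fset pt R}) :
  fset_of_set l `&` A = fset_of_set (l :&: [set p : P | val p \in A])%SET.
Proof.
apply/fsetP => p; rewrite in_fsetI; apply/andP/imfsetP => [[/imfsetP[q ql ->] qA]|[q]].
  by exists q; rewrite // !inE ql.
by rewrite !inE => /andP[ql qA] ->; rewrite mem_fset_of_set.
Qed.

Lemma fset_of_trace l : l \in traces -> det_trace P (fset_of_set l).
Proof.
rewrite inE => /andP[l1 /asboolP[a [b [c [ab lE]]]]]; split; first by rewrite card_fset_of_set.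
exists a, b, c; rewrite ab /=; apply/eqP/fsetP => p; rewrite !inE /=.
apply/imfsetP/andP => [[q ql ->]|[pP pl]]; first by rewrite -lE; split => //; apply: valP.
by exists (Sub p pP) => //=; rewrite lE.
Qed.
End Traces.

Theorem theorem3p1 (R : realType) (n k : nat) (G Rd : {fset pt R}) :
  (k <= n)%N ->
  #|` G| = n -> #|` Rd| = (n - k)%N -> [disjoint G & Rd] ->
  (forall a b c : R[i], is_line a b ->
     (#|` pts_on (G `|` Rd) a b c| + 2 <= 2 * n - k)%N) ->
  ((6 * n)%:R - (k * (k + 3))%:R) / 4 <= (#|` equi_lines 1 6 G Rd|)%:R :> R.
Proof.
move=> kn cG cRd dGR few; set P := G `|` Rd.
pose G' : {set P} := [set p : P | val p \in G].
have sGP : G `<=` P by apply: fsubsetUl.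
have G'E : fset_of_set G' = G.
  apply/fsetP => p; apply/imfsetP/idP => [[q qG ->]|pG]; first by rewrite inE in qG.
  by exists (Sub p (fsubsetP sGP p pG)) => //=; rewrite inE.
have RdE (p : P) : (val p \in Rd) = (p \notin G').
  have : val p \in G `|` Rd by apply: valP.
  rewrite in_set in_fsetU; case: (boolP (val p \in G)) => //= pG _.
  by apply/negbTE; apply: (fdisjointP dGR).
have sRP : Rd `<=` P by apply: fsubsetUr.
have CG'E : fset_of_set (~: G')%SET = Rd.
  apply/fsetP => p; apply/imfsetP/idP => [[q qG ->]|pR].
    by rewrite RdE; rewrite inE in qG.
  by exists (Sub p (fsubsetP sRP p pR)) => //=; rewrite inE -RdE.
have cG' : #|G'| = n by rewrite -card_fset_of_set G'E.
have cCG' : #|(~: G')%SET| = (n - k)%N by rewrite -card_fset_of_set CG'E.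
have cP : #|{: P}| = (2 * n - k)%N by rewrite -(cardsC G') cG' cCG'; lia.
have Lcard l : l \in traces P -> (2 <= #|l| /\ #|l| + 2 <= #|{: P}|)%N.
  move=> lL; have [] := fset_of_trace lL; rewrite card_fset_of_set => l2.
  move=> [a [b [c /andP[ab /eqP lE]]]]; split=> //.
  by rewrite -card_fset_of_set lE cP; apply: few.
have P3 : (3 <= #|{: P}|)%N.
  (* The hypothesis on any one line, here x = 0, already gives two points. The line joining two
     points then has at least two points and misses at least two. *)
  have P2 : (2 <= #|{: P}|)%N.
    rewrite cP; apply: leq_trans (few 1 0 0 _); first by rewrite leq_addl.
    by rewrite /is_line oner_eq0.
  have /card_gt1P[i [j [_ _ ij]]] := P2.
  have [l lL _] := (traces_linear_space P).1 i j ij.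
  by have [] := Lcard l lL; lia.
have hirz := hirzebruch_inequality (traces_linear_space P) (@trace_det _ P) (@trace_null _ P) P3 Lcard.
have count := equichromatic_count G' (traces_linear_space P) (fun l lL => (Lcard l lL).1) hirz.
set E := [set l in _ | _]%SET in count.
have : (#|E| <= #|` equi_lines 1 6 G Rd|)%N.
  rewrite -(card_imfset_set _ (@fset_of_set_inj _ P)); apply: fsubset_leq_card.
  apply/fsubsetP => S /imfsetP[l]; rewrite inE => /andP[lL /andP[l6 leq]] ->.
  rewrite !inE fpowersetE fset_of_set_sub /= card_fset_of_set l6 andbT.
  rewrite !fset_of_setI !card_fset_of_set -/G'.
  rewrite (_ : [set p : P | val p \in Rd]%SET = ~: G')%SET; last first.
    by apply/setP => p; rewrite [LHS]in_set RdE in_setC.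
  rewrite -setDE leq andbT; apply/asboolP; exact: fset_of_trace.
rewrite -(ler_nat R); move: count; rewrite cG' cCG' cP.
have -> : (2 * n - k = n + (n - k))%N by lia.
(* With N = k + 2m points and colour difference k, 3N - k^2 = 6n - k(k + 3). *)
have [m ->] : exists m, n = (k + m)%N by exists (n - k)%N; lia.
rewrite addKn; move: #|` _| => e; move: #|E| => e'.
rewrite !(natrD, natrM).
by lra.
Qed.
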